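(* Let $R$ be an exchange ring, and let $[a,b]$ (with $a,b\in R$) be a completable row. Then there exist $c,d\in R$ such that $$\begin{bmatrix}a & b\\ c& d\end{bmatrix}\in \mathrm{GL}_2(R),$$ with $RcR=R$ and $c$ regular.
   Context: Rings are associative and unital. A ring $R$ is an exchange ring if the right module $R_R$ has the finite exchange property; equivalently, for every $a\in R$ there is an idempotent $e\in aR$ with $1-e\in (1-a)R$. A row $[a,b]$ is right unimodular if $aR+bR=R$; a right unimodular row is completable if it is the top row of some matrix in $\mathrm{GL}_2(R)$. An element $c\in R$ is (von Neumann) regular if $cxc=c$ for some $x\in R$. $RcR$ is the two-sided ideal generated by $c$. *)

(* Defs.v *)
From HB Require Import structures.
From mathcomp Require Import all_boot all_order all_algebra.

Set Implicit Arguments.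
Unset Strict Implicit.
Unset Printing Implicit Defensive.

Import GRing.Theory.
Local Open Scope ring_scope.

(* Submodules are Prop-valued predicates, rather than the boolean ones of
   submod_closed, so that arbitrary submodules are covered. *)
Definition submodule (S : pzRingType) (A : lmodType S) (B : A -> Prop) : Prop :=
  B 0 /\ forall (s : S) (x y : A), B x -> B y -> B (s *: x + y).

Definition internal_direct_sum (S : pzRingType) (A : lmodType S) (I : finType)
    (B : I -> A -> Prop) : Prop :=
  (forall i, submodule (B i)) /\
  (forall x : A, exists! f : {ffun I -> A},
     (forall i, B i (f i)) /\ x = \sum_i f i).

Definition image_of (T U : Type) (f : T -> U) (y : U) : Prop :=
  exists x, y = f x.

(* If A = M' (+) N = B_1 (+) ... (+) B_n with M' isomorphic to M, then
   A = M' (+) B'_1 (+) ... (+) B'_n for some submodules B'_i of the B_i.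
   Here M' is the image of an injective linear map g : M -> A. *)
Definition finite_exchange_property (S : pzRingType) (M : lmodType S) : Prop :=
  forall (A : lmodType S) (g : {linear M -> A}) (N : A -> Prop)
         (n : nat) (B : 'I_n -> A -> Prop),
    injective g ->
    internal_direct_sum (fun k : bool => if k then image_of g else N) ->
    internal_direct_sum B ->
    exists B' : 'I_n -> A -> Prop,
      (forall i x, B' i x -> B i x) /\
      internal_direct_sum
        (fun o : option 'I_n => if o is Some i then B' i else image_of g).

(* Right R-modules are left modules over the converse ring R^c; the right
   module R_R is thus the regular left module (R^c)^o, in which
   r *: x is the product x * r of R. *)
Definition exchange_ring (R : pzRingType) : Prop :=
  @finite_exchange_property R^c (R^c)^o.

(* unitmx requires commutative coefficients, hence the explicit two-sided
   inverse. *)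
Definition in_GL2 (R : pzRingType) (A : 'M[R]_2) : Prop :=
  exists B : 'M[R]_2, A *m B = 1%:M /\ B *m A = 1%:M.

Definition mx22 (R : pzRingType) (a b c d : R) : 'M[R]_2 :=
  \matrix_(i, j) if i == 0 then (if j == 0 then a else b)
                 else (if j == 0 then c else d).

Definition right_unimodular (R : pzRingType) (a b : R) : Prop :=
  forall z : R, exists x y : R, a * x + b * y = z.

Definition completable (R : pzRingType) (a b : R) : Prop :=
  right_unimodular a b /\
  exists A : 'M[R]_2, in_GL2 A /\ A 0 0 = a /\ A 0 1 = b.

Definition von_neumann_regular (R : pzRingType) (c : R) : Prop :=
  exists x : R, c * x * c = c.

(* Membership in the two-sided ideal RcR. *)
Definition in_ideal_gen (R : pzRingType) (c z : R) : Prop :=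
  exists (n : nat) (u v : 'I_n -> R), z = \sum_(i < n) u i * c * v i.

(* Main.v *)
Require Import Defs.
From HB Require Import structures.
From mathcomp Require Import all_boot all_order all_algebra.

Set Implicit Arguments.
Unset Strict Implicit.
Unset Printing Implicit Defensive.

Import GRing.Theory.
Local Open Scope ring_scope.

(** Let A be any completion of the row (a, b), and p its lower left entry.
Adding t times the first row of A to the second one keeps the matrix invertible
and replaces p by p + t a; so the point is to choose t such that p + t a is
regular and generates R as an ideal.

The first column of A is left unimodular, say x a + y p = 1. In an exchange
ring there is then an idempotent e in R a with f = 1 - e in R p, say f = s p
with s = f s. Any v in R e is a left multiple of a, so p f + v has the form p +
t a. Here p f is regular with s p f = f, so it generates the ideal R f R, and
the idempotent g = p s generates the same right ideal as p f. With h = 1 - g,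
an element v of h R e does not interfere with p f: p f + v is regular as soon
as v is, and the ideal that it generates contains both v and f.

It remains to choose v. With v = h e the ideals of v and f add up to R, but h e
need not be regular. Instead the exchange property of the corner h R h, applied
to h e h, gives an idempotent k = r h e h with h - k in R h f h. The element v
= r e is regular since v k = k and k v = v, and 1 = k + (h - k) + g, where k
lies in R v R, while h - k and g lie in R f R.

The exchange property is thus used only in the form: for every a there is an
idempotent of R a with complement in R (1 - a). This comes from exchanging the
image of t |-> (a t, (1 - a) t), a direct summand of R x R isomorphic to R,
with the two coordinate axes. Although R is exchanged as a right module, the
idempotents come out in left ideals: the projection of R x R onto the summand
is left multiplication by a row (r, s), and composing it with the embedding
gives r a + s (1 - a) = 1. *)

(** * Direct sums and the exchange of a summand of a square *)

Lemma big_option_ord (V : nmodType) (n : nat) (F : option 'I_n -> V) :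
  \sum_o F o = F None + \sum_i F (Some i).
Proof.
rewrite (bigD1 None) //=; congr (_ + _).
rewrite (reindex_omap Some id) => [|[i|] //].
by apply: eq_bigl => i; rewrite eqxx.
Qed.

Lemma internal_direct_sum_eq0 (S : pzRingType) (A : lmodType S) (I : finType)
    (B : I -> A -> Prop) (f : {ffun I -> A}) :
  internal_direct_sum B -> (forall i, B i (f i)) -> \sum_i f i = 0 ->
  forall i, f i = 0.
Proof.
case=> Bsub Bdec Bf f0 i.
have [f' [_ f'U]] := Bdec 0.
rewrite -(f'U f); last by split.
rewrite (f'U [ffun=> 0]) ?ffunE //; split=> [j|].
  by rewrite ffunE; case: (Bsub j).
by rewrite big1 // => j _; rewrite ffunE.
Qed.

Lemma submodule_ker (S : pzRingType) (A B : lmodType S) (h : {linear A -> B}) :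
  submodule (fun x => h x = 0).
Proof.
split=> [|s x y hx hy]; first exact: linear0.
by rewrite linearP hx hy scaler0 addr0.
Qed.

Lemma submodule_image (S : pzRingType) (A B : lmodType S)
    (g : {linear A -> B}) :
  submodule (image_of g).
Proof.
split=> [|s x y [u ->] [v ->]]; first by exists 0; rewrite linear0.
by exists (s *: u + v); rewrite linearP.
Qed.

Lemma internal_direct_sum_split (S : pzRingType) (U A : lmodType S)
    (g : {linear U -> A}) (h : {linear A -> U}) :
  cancel g h ->
  internal_direct_sum (fun k : bool => if k then image_of g
                                       else fun x => h x = 0).
Proof.
move=> gK; split=> [[]|x]; [exact: submodule_image|exact: submodule_ker|].
exists [ffun k : bool => if k then g (h x) else x - g (h x)]; split.
  split; last by rewrite big_bool !ffunE /= addrC subrK.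
  case; rewrite ffunE /=; first by exists (h x).
  by rewrite linearB /= gK subrr.
move=> f [Bf xE]; apply/ffunP; rewrite big_bool in xE.
have [t ft] := Bf true; have ff := Bf false; rewrite /= in ff.
have hx : h x = t by rewrite xE linearD /= ff addr0 ft gK.
by case; rewrite ffunE hx -ft // xE addrC addKr.
Qed.

Lemma internal_direct_sum_prod (S : pzRingType) (U V : lmodType S) :
  internal_direct_sum (fun (i : 'I_2) (p : U * V) =>
                         if i == 0 then p.2 = 0 else p.1 = 0).
Proof.
split=> [i|[x y]].
  by case: (i == 0); split=> //= s x y -> ->; rewrite scaler0 addr0.
exists [ffun i : 'I_2 => if i == 0 then (x, 0) else (0, y)]; split.
  split=> [i|]; first by rewrite ffunE; case: (i == 0).
  rewrite !big_ord_recl big_ord0 !ffunE /= addr0.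
  by congr pair; rewrite /= ?addr0 ?add0r.
move=> f [Bf]; rewrite !big_ord_recl big_ord0 /= addr0.
have := Bf ord0; have := Bf (lift ord0 ord0).
rewrite /=; case E0: (f ord0) => [u u']; case E1: (f _) => [v' v] /= v'0 u'0.
rewrite {}v'0 in E1 *; rewrite {}u'0 in E0 *.
case; rewrite /= addr0 add0r => -> ->.
apply/ffunP => i; rewrite ffunE; case: eqP => [->|]; first by rewrite -E0.
case: i => [[|[|//]]] i i0.
  by case: i0; apply/val_inj.
by rewrite -E1; congr (f _); apply/val_inj.
Qed.

(** The finite exchange property for the two coordinate axes of U x U. The
complements of the image of g lie on the axes, hence are given by submodules C
and D of U itself; this keeps all computations inside U. *)
Lemma exchange_square (S : pzRingType) (U : lmodType S)
    (g : {linear U -> (U * U)%type}) (h : {linear (U * U)%type -> U}) :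
    finite_exchange_property U -> cancel g h ->
  exists C D : U -> Prop, [/\ submodule C, submodule D,
    forall p, exists t c d, [/\ C c, D d & p = g t + (c, d)] &
    forall t c d, C c -> D d -> g t + (c, d) = 0 -> t = 0].
Proof.
move=> Uex gK.
have [B' [B'B B'dec]] :=
  Uex _ _ _ _ _ (can_inj gK) (internal_direct_sum_split gK)
      (internal_direct_sum_prod U U).
have [B'sub B'ex] := B'dec.
pose i1 : 'I_2 := lift ord0 ord0.
have [C0 Cl] := B'sub (Some ord0); have [D0 Dl] := B'sub (Some i1).
exists (fun c => B' ord0 (c, 0)), (fun d => B' i1 (0, d)); split.
- split=> // s x y Cx Cy; have := Cl s _ _ Cx Cy.
  by congr (B' _ (_, _)); rewrite /= scaler0 addr0.
- split=> // s x y Cx Cy; have := Dl s _ _ Cx Cy.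
  by congr (B' _ (_, _)); rewrite /= scaler0 addr0.
- move=> p; have [f [[Bf pE] _]] := B'ex p.
  have [t ft] := Bf None.
  have := Bf (Some ord0); have := Bf (Some i1).
  rewrite pE big_option_ord !big_ord_recl big_ord0 addr0 ft -/i1.
  case E0: (f (Some ord0)) => [c c']; case E1: (f _) => [d' d].
  move=> Bd Bc; have /= c'0 := B'B _ _ Bc; have /= d'0 := B'B _ _ Bd.
  rewrite {}c'0 {}d'0 in Bc Bd *.
  exists t, c, d; split=> //; congr (_ + (_, _)); rewrite /= ?addr0 ?add0r //.
- move=> t c d Cc Dd E.
  pose f : {ffun option 'I_2 -> (U * U)%type} :=
    [ffun o => if o is Some i then if i == 0 then (c, 0) else (0, d) else g t].
  suff gt0 : f None = 0 by rewrite ffunE in gt0; rewrite -[t]gK gt0 linear0.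
  apply: (internal_direct_sum_eq0 B'dec).
    case=> [i|]; rewrite ffunE; last by exists t.
    case: eqP => [->//|]; case: i => [[|[|//]]] i i0.
      by case: i0; apply/val_inj.
    by move: Dd; congr (B' _ _); apply/val_inj.
  rewrite big_option_ord !big_ord_recl big_ord0 !ffunE /= addr0 -{}E.
  by congr (_ + (_, _)); rewrite /= ?addr0 ?add0r.
Qed.

(** * Idempotents in exchange rings *)

(** In (R^c)^o scalars act by right multiplication, so left multiplications by
elements of R are linear. *)
Definition left_mul_pair (R : pzRingType) (a b : R) (t : (R^c)^o) :
  ((R^c)^o * (R^c)^o)%type := ((a : R) * (t : R), (b : R) * (t : R)).

Fact left_mul_pair_linear (R : pzRingType) (a b : R) :
  linear (left_mul_pair a b).
Proof.
move=> s x y; rewrite /left_mul_pair.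
by congr (_, _); rewrite /= (@mulrDr R) (@mulrA R).
Qed.

HB.instance Definition _ (R : pzRingType) (a b : R) :=
  GRing.isLinear.Build _ _ _ _ (left_mul_pair a b) (left_mul_pair_linear a b).

Definition pair_sum (S : pzRingType) (U : lmodType S) (p : U * U) : U :=
  p.1 + p.2.

Fact pair_sum_linear (S : pzRingType) (U : lmodType S) :
  linear (@pair_sum S U).
Proof. by move=> s p q; rewrite /pair_sum /= scalerDr addrACA. Qed.

HB.instance Definition _ (S : pzRingType) (U : lmodType S) :=
  GRing.isLinear.Build _ _ _ _ (@pair_sum S U) (@pair_sum_linear S U).

(** The product r a is the idempotent of R a announced above, and s (1 - a) its
complement. Decompose (1, 0) = (a r, b r) + (c, d) and (0, 1) = (a s, b s) +
(c', d') with b = 1 - a: then (r, s) is the projection onto the summand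
{(a t, b t)}. It maps (a, b) to 1, that is r a + s b = 1, and it kills
(c, 0) = (1 - a r, 0), that is r a r = r. *)
Lemma exchange_ring_left_idempotent (R : pzRingType) :
  exchange_ring R ->
  forall a : R, exists r s : R, r * a * r = r /\ r * a + s * (1 - a) = 1.
Proof.
move=> Rex a; set b := 1 - a.
pose g : {linear (R^c)^o -> ((R^c)^o * (R^c)^o)%type} := left_mul_pair a b.
pose h : {linear ((R^c)^o * (R^c)^o)%type -> (R^c)^o} := @pair_sum _ _.
have gK : cancel g h.
  move=> t; rewrite /g /h /= /pair_sum /=.
  by rewrite -(@mulrDl R) /b addrC subrK (@mul1r R).
clearbody b.
have [C [D [[C0 Cl] [D0 Dl] dec ind]]] := exchange_square Rex gK.
have [r [c [d [Cc Dd /esym E1]]]] := dec (1, 0).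
have [s [c' [d' [Cc' Dd' /esym E2]]]] := dec (0, 1).
move: E1 E2 => [E11 E12] [E21 E22].
(* The action of t on (R^c)^o is right multiplication by t, so C and D are
   right ideals of R. *)
have CM x t : C x -> C ((x : R) * t).
  by move=> Cx; have := Cl t _ _ Cx C0; rewrite addr0.
have DM x t : D x -> D ((x : R) * t).
  by move=> Dx; have := Dl t _ _ Dx D0; rewrite addr0.
have CD x y : C x -> C y -> C (x + y).
  by move=> Cx Cy; have := Cl 1 _ _ Cx Cy; rewrite scale1r.
have DD x y : D x -> D y -> D (x + y).
  by move=> Dx Dy; have := Dl 1 _ _ Dx Dy; rewrite scale1r.
have {}ind (t x y : R) : C x -> D y -> a * t + x = 0 -> b * t + y = 0 -> t = 0.
  by move=> Cx Dy Ex Ey; apply: ind Cx Dy _; congr (_, _).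
(* The casts to R select its own product instead of that of R^c. *)
have E11' : a * (r : R) + c = 1 := E11.
have E12' : b * (r : R) + d = 0 := E12.
have E21' : a * (s : R) + c' = 0 := E21.
have E22' : b * (s : R) + d' = 1 := E22.
have rc0 : (r : R) * c = 0.
  apply: (ind _ ((c : R) * (c - 1)) ((d : R) * c)); [exact: CM|exact: DM| |].
    by rewrite mulrA mulrBr mulr1 addrA -mulrDl E11' mul1r subrr.
  by rewrite mulrA -mulrDl E12' mul0r.
exists r, s; split.
  have /= := congr1 (fun x => (r : R) * x) E11'.
  by rewrite mulrDr rc0 addr0 mulr1 mulrA.
(* The two decompositions multiplied by a and b and added, in either
   coordinate: x stands for a or b, and x' for the entry of (1, 0) there. *)
have rs (x y x' y' : R) : x * (r : R) + y = x' -> x * (s : R) + y' = 1 - x' ->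
    x * ((r : R) * a + (s : R) * b - 1) + (y * a + y' * b)
      = x' * a + (1 - x') * b - x.
  move=> <- E; rewrite -E !mulrDr mulrN1 !mulrDl !mulrA.
  by rewrite addrAC addrACA.
apply/subr0_eq.
apply: (ind _ ((c : R) * a + (c' : R) * b) ((d : R) * a + (d' : R) * b)).
- by apply: CD; apply: CM.
- by apply: DD; apply: DM.
- by rewrite (rs _ _ 1 _ E11') ?E21' ?subrr // mul1r mul0r addr0 subrr.
by rewrite (rs _ _ 0 _ E12') ?E22' ?subr0 // mul1r mul0r add0r subrr.
Qed.

(** The exchange property passes to the corner h R h: extend x by 1 - h to an
element of R with the same complement h - x, and cut the resulting r and s
down by h. *)
Lemma exchange_corner_left_idempotent (R : pzRingType) (h x : R) :
  exchange_ring R -> h * h = h -> h * x * h = x ->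
  exists r s : R,
    [/\ h * r = r, r * h = r, r * x * r = r & r * x + s * (h - x) = h].
Proof.
move=> Rex hh hxh.
have [hx xh] : h * x = x /\ x * h = x by rewrite -hxh -!mulrA hh !mulrA hh.
have [r [s [rXr rXs]]] := exchange_ring_left_idempotent Rex (x + (1 - h)).
have CX : 1 - (x + (1 - h)) = h - x by rewrite opprD addrCA subKr addrC.
have Xh : (x + (1 - h)) * h = x by rewrite mulrDl mulrBl mul1r hh subrr addr0.
have hC : h * (1 - h) = 0 by rewrite mulrBr mulr1 hh subrr.
have xC : x * (1 - h) = 0 by rewrite -xh -mulrA hC mulr0.
have CC : (1 - h) * (1 - h) = 1 - h by rewrite mulrBl mul1r hC subr0.
rewrite {}CX in rXs.
have rC : r * (1 - h) = 1 - h.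
  have /= := congr1 (fun z => z * (1 - h)) rXs.
  rewrite mulrDl mul1r -!mulrA [(h - x) * _]mulrBl hC xC subrr mulr0 addr0.
  by rewrite [(x + _) * _]mulrDl xC add0r CC.
have hrxr : h * r * x * r = h * r.
  rewrite -[x](addrK (1 - h)) [_ * (_ - _)]mulrBr mulrBl.
  by rewrite -2!(mulrA h) rXr -(mulrA h r (1 - h)) rC hC mul0r subr0.
exists (h * r * h), (h * s); split.
- by rewrite !mulrA hh.
- by rewrite -mulrA hh.
- by rewrite -[_ * h * x]mulrA hx !mulrA -[_ * x * h]mulrA xh hrxr.
rewrite -[_ * h * x]mulrA hx.
have /= := congr1 (fun z => h * z * h) rXs.
by rewrite mulr1 hh mulrDr mulrDl -!mulrA Xh mulrBl hh xh.
Qed.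

(** * Regular full elements in a left unimodular column *)

Lemma in_ideal_gen_self (R : pzRingType) (c : R) : in_ideal_gen c c.
Proof.
by exists 1%N, (fun=> 1), (fun=> 1); rewrite big_ord1 mul1r mulr1.
Qed.

Lemma in_ideal_genD (R : pzRingType) (c x y : R) :
  in_ideal_gen c x -> in_ideal_gen c y -> in_ideal_gen c (x + y).
Proof.
move=> [m [u [v ->]]] [n [u' [v' ->]]]; exists (m + n)%N.
exists (fun i => match split i with inl j => u j | inr j => u' j end).
exists (fun i => match split i with inl j => v j | inr j => v' j end).
rewrite big_split_ord /=; congr (_ + _); apply: eq_bigr => i _.
  by rewrite (unsplitK (inl i)).
by rewrite (unsplitK (inr i)).
Qed.

Lemma in_ideal_genM (R : pzRingType) (c x y z : R) :
  in_ideal_gen c y -> in_ideal_gen c (x * y * z).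
Proof.
move=> [n [u [v ->]]]; exists n, (fun i => x * u i), (fun i => v i * z).
by rewrite mulr_sumr mulr_suml; apply: eq_bigr => i _; rewrite !mulrA.
Qed.

(** For a suitable t the shift c0 + t a equals c0 f + v, where f is the
part of 1 reached from c0, and v = r e uses the part reached from a to fill
the complement h of the image of c0 f. *)
Lemma exchange_regular_full_shift (R : pzRingType) (x a y c0 : R) :
  exchange_ring R -> x * a + y * c0 = 1 ->
  exists t : R, von_neumann_regular (c0 + t * a) /\
                forall z, in_ideal_gen (c0 + t * a) z.
Proof.
move=> Rex xayc.
have [r0 [s0 [e_idem ef1]]] := exchange_ring_left_idempotent Rex (x * a).
have yc0 : 1 - x * a = y * c0 by rewrite -xayc addrC addKr.
pose e := r0 * (x * a); pose f := s0 * (y * c0); pose s := f * (s0 * y).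
have ee : e * e = e by rewrite /e mulrA e_idem.
have fE : f = 1 - e by rewrite -ef1 yc0 addrC addKr.
have ff : f * f = f by rewrite fE mulrBr mulr1 mulrBl mul1r ee subrr subr0.
have fe : f * e = 0 by rewrite fE mulrBl mul1r ee subrr.
have sc0 : s * c0 = f by rewrite /s -(mulrA f) -(mulrA s0) ff.
have fs : f * s = s by rewrite /s mulrA ff.
clearbody s; clearbody f.
pose g := c0 * s; pose h := 1 - g.
have gg : g * g = g by rewrite /g -mulrA (mulrA s) sc0 fs.
have hh : h * h = h by rewrite /h mulrBr mulr1 mulrBl mul1r gg subrr subr0.
have sh : s * h = 0 by rewrite /h mulrBr mulr1 /g mulrA sc0 fs subrr.
have hc0f : h * (c0 * f) = 0.
  by rewrite /h mulrBl mul1r /g -mulrA (mulrA s) sc0 ff subrr.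
(* Exchanging inside h R h makes k = r (h e h) an idempotent below h which is
   reached through e, with complement h - k reached through f. *)
have [r [s' [hr rh rxr rxs]]] : exists r s' : R,
    [/\ h * r = r, r * h = r, r * (h * e * h) * r = r
      & r * (h * e * h) + s' * (h - h * e * h) = h].
  by apply: exchange_corner_left_idempotent; rewrite // -!mulrA hh !mulrA hh.
pose v := r * e; pose k := r * (h * e * h).
have ve : v * e = v by rewrite /v -mulrA ee.
have vf : v * f = 0 by rewrite fE mulrBr mulr1 ve subrr.
have hk : h * k = k by rewrite /k [LHS]mulrA hr.
have kh : k * h = k by rewrite /k -!mulrA hh.
have kv : k * v = v by rewrite /v mulrA rxr.
have vk : v * k = k.
  have kk : k * k = k by rewrite /k mulrA rxr.
  by rewrite -[RHS]kk -[X in v * X]hk {2}/k /v !mulrA rh.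
have sv : s * v = 0 by rewrite /v -hr !mulrA sh !mul0r.
(* As e = r0 x a, this t gives c0 + t a = c0 + (r - c0) e = c0 f + r e. *)
exists ((r - c0) * r0 * x).
set c := c0 + _.
have cE : c = c0 * f + v.
  by rewrite /c /v fE /e mulrBr mulr1 !mulrBl !mulrA addrA addrAC.
rewrite -/k in rxs; clearbody c k v.
have sc : s * c = f by rewrite cE mulrDr sv addr0 mulrA sc0 ff.
have cf : c * f = c0 * f by rewrite cE mulrDl vf addr0 -mulrA ff.
have ce : c * e = v by rewrite cE mulrDl ve -mulrA fe mulr0 add0r.
have kc : k * c = v by rewrite cE mulrDr kv -kh -mulrA hc0f mulr0 add0r.
split.
  (* s inverts c0 f and kills v, while e k inverts v and kills c0 f. *)
  exists (s + e * k).
  by rewrite mulrDr mulrDl -(mulrA c s) sc cf (mulrA c e) ce vk kc -cE.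
have If : in_ideal_gen c f.
  by rewrite -sc -[s * c]mulr1; apply: in_ideal_genM; apply: in_ideal_gen_self.
have I1 : in_ideal_gen c 1.
  have -> : 1 = k + s' * h * f * h + c0 * f * s.
    rewrite -[c0 * f * s]mulrA fs -/g -[LHS](subrK g) -/h; congr (_ + _).
    clearbody h; rewrite -[LHS]rxs -!(mulrA s'); congr (_ + _ * _).
    by rewrite fE mulrBr mulr1 mulrBl hh.
  apply: in_ideal_genD; last exact: in_ideal_genM.
  apply: in_ideal_genD; last exact: in_ideal_genM.
  have -> : k = 1 * c * (e * k) by rewrite mul1r mulrA ce vk.
  by apply: in_ideal_genM; apply: in_ideal_gen_self.
by move=> z; rewrite -[z]mulr1 -[z * 1]mulr1; apply: in_ideal_genM.
Qed.

(** * Completions of a row *)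

Lemma mulmx2E (R : pzRingType) (A B : 'M[R]_2) i j :
  (A *m B) i j = A i 0 * B 0 j + A i 1 * B 1 j.
Proof.
by rewrite mxE !big_ord_recl big_ord0 addr0; congr (_ + A i _ * B _ j);
  apply/val_inj.
Qed.

Lemma in_GL2M (R : pzRingType) (A B : 'M[R]_2) :
  in_GL2 A -> in_GL2 B -> in_GL2 (A *m B).
Proof.
move=> [A' [AA' A'A]] [B' [BB' B'B]]; exists (B' *m A'); split.
  by rewrite mulmxA -(mulmxA A) BB' mulmx1.
by rewrite mulmxA -(mulmxA B') A'A mulmx1.
Qed.

Lemma matrix2P (R : pzRingType) (A B : 'M[R]_2) :
  A 0 0 = B 0 0 -> A 0 1 = B 0 1 -> A 1 0 = B 1 0 -> A 1 1 = B 1 1 -> A = B.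
Proof.
move=> E00 E01 E10 E11; apply/matrixP.
have ord2 (i : 'I_2) : i = 0 \/ i = 1.
  by case: i => [[|[|//]]] ?; [left|right]; apply/val_inj.
by move=> i j; case: (ord2 i) => ->; case: (ord2 j) => ->.
Qed.

Lemma in_GL2_lower (R : pzRingType) (t : R) : in_GL2 (mx22 1 0 t 1).
Proof.
have E u w : u + w = 0 -> mx22 1 0 u 1 *m mx22 1 0 w 1 = 1%:M :> 'M[R]_2.
  move=> uw; apply: matrix2P; rewrite mulmx2E !mxE /=.
  - by rewrite !(mul1r, mul0r, addr0).
  - by rewrite !(mulr1, mulr0, addr0).
  - by rewrite !(mulr1, mul1r, mulr0, addr0).
  - by rewrite !(mulr1, mulr0, add0r).
by exists (mx22 1 0 (- t) 1); split; apply: E; rewrite ?subrr ?addNr.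
Qed.

Theorem proposition6p6 (R : pzRingType) (hR : exchange_ring R)
    (a b : R) (hab : completable a b) :
  exists c d : R,
    in_GL2 (mx22 a b c d) /\
    (forall z : R, in_ideal_gen c z) /\
    von_neumann_regular c.
Proof.
have [_ [A [[B [AB BA]] [A00 A01]]]] := hab.
have col0 : B 0 0 * a + B 0 1 * A 1 0 = 1 by rewrite -A00 -mulmx2E BA mxE.
have [t [creg cfull]] := exchange_regular_full_shift hR col0.
exists (A 1 0 + t * a), (A 1 1 + t * b); split=> //.
have -> : mx22 a b (A 1 0 + t * a) (A 1 1 + t * b) = mx22 1 0 t 1 *m A.
  by apply: matrix2P; rewrite mulmx2E !mxE /= ?A00 ?A01 ?(mul1r, mul0r, addr0)
     // addrC.
by apply: in_GL2M; [exact: in_GL2_lower|exists B].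
Qed.
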